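(* Let $q\in(0,1)$, let $n\ge 1$ be an integer, let $x_k>0$ for $1\le k\le n$, and let $p_k\ge 0$ for $1\le k\le n$ with $\sum_{k=1}^n p_k=1$. If $\alpha,\beta$ are real numbers with $2\alpha\le 1\le\beta$, then $$\frac{\Gamma_q\left(\sum_{k=1}^n p_kx_k+\beta\right)}{\prod_{k=1}^n\left[\Gamma_q(x_k+\beta)\right]^{p_k}}\le\frac{\left(\frac{1-q^{\sum_{k=1}^n p_kx_k}}{1-q}\right)^{\sum_{k=1}^n p_kx_k+\beta-\alpha}}{\prod_{k=1}^n\left(\frac{1-q^{x_k}}{1-q}\right)^{p_k(x_k+\beta-\alpha)}}\exp\left(\frac{\mathrm{Li}_2\left(1-q^{\sum_{k=1}^n p_kx_k}\right)-\sum_{k=1}^n p_k\,\mathrm{Li}_2(1-q^{x_k})}{\log q}\right).$$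
   Context: For $0<q<1$ and $x>0$, the $q$-gamma function is $\Gamma_q(x)=(1-q)^{1-x}\prod_{j=0}^{\infty}\frac{1-q^{j+1}}{1-q^{j+x}}$. The dilogarithm is $\mathrm{Li}_2(z)=-\int_0^z\frac{\log(1-t)}{t}\,dt$ for $0<z<1$. *)

(* Defs.v *)
From Stdlib Require Import Reals.
From Coquelicot Require Import Coquelicot.

Open Scope R_scope.

(* Product over s <= k <= n (for s <= n), the companion of Stdlib's [sum_f]. *)
Definition prod_f (s n : nat) (f : nat -> R) : R :=
  prod_f_R0 (fun k => f (k + s)%nat) (n - s).

(* The infinite product is the limit of its partial products over 0 <= j <= N,
   which exists and is positive and finite for 0 < q < 1 and 0 < x. *)
Definition Gamma_q (q x : R) : R :=
  Rpower (1 - q) (1 - x) *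
  real (Lim_seq (fun N =>
    prod_f_R0 (fun j => (1 - q ^ (j + 1)) / (1 - Rpower q (INR j + x))) N)).

(* The singularity of the integrand at t = 0 is removable, so for 0 < z < 1
   this is a proper Riemann integral whatever the value given to the integrand
   at 0. *)
Definition Li2 (z : R) : R := - RInt (fun t => ln (1 - t) / t) 0 z.

(* Main.v *)
Require Import Defs.
From Stdlib Require Import Reals Lra Lia.
From Coquelicot Require Import Coquelicot.

Open Scope R_scope.

(** Taking logarithms turns the claim into Jensen's inequality for
    [F(t) = ln Gamma_q(t + beta) - (t + beta - alpha) ln ((1 - q^t) / (1 - q))
            - Li2(1 - q^t) / ln q],
    so the point is that [F] is convex on (0, +oo).  The dilogarithm term is
    exactly what cancels the factor [t] in the derivative of the middle term.
    Writing [h(t) = (ln q)^2 q^t / (1 - q^t)^2] and [I(t)] for the integral of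
    [h] over [t, +oo), which equals [- ln q q^t / (1 - q^t)], one gets
    [F''(t) = sum_(j >= 0) h(t + beta + j) - I(t) + (beta - alpha) h(t)].
    The kernel [h] is decreasing and satisfies the trapezoidal inequality of a
    convex function on intervals of length one ([qkernel_trapezoid]).
    Integrating [h] over [t, t + beta - 1] by monotonicity ([qtail_diff_le])
    and over the rest by the trapezoidal rule ([qtail_le_sum_qkernel]) gives
    [I(t) <= (beta - 1) h(t) + h(t + beta - 1) / 2
             + sum_(j >= 0) h(t + beta + j)],
    and [beta - 1 + 1/2 <= beta - alpha] makes [F''] nonnegative.

    To avoid differentiating an infinite product, the product is truncated
    after finitely many factors.  The missing part of the sum is then paid for
    by the term [e_N t^2 / 2], where [e_N] is a constant that dominates
    [I(t + beta + N)] for all [t > 0] and tends to 0.  Each truncation is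
    convex, hence satisfies Jensen's inequality, which passes to the limit in
    [N] ([log_defect_jensen]). *)

(** * Convexity from the second derivative *)

Lemma nondecreasing_of_derive (f df : R -> R) :
  (forall t, 0 < t -> is_derive f t (df t)) ->
  (forall t, 0 < t -> 0 <= df t) ->
  forall a b, 0 < a -> a <= b -> f a <= f b.
Proof.
intros Hf Hdf a b Ha Hab.
destruct (MVT_gen f a b df) as [c [Hc Heq]].
- intros t Ht; apply Hf; rewrite Rmin_left in Ht; lra.
- intros t Ht; apply derivable_continuous_pt; exists (df t).
  apply is_derive_Reals, Hf; rewrite Rmin_left in Ht; lra.
- rewrite Rmin_left in Hc by lra.
  assert (0 <= df c) by (apply Hdf; lra).
  nra.
Qed.

Lemma tangent_line_below (f df ddf : R -> R) :
  (forall t, 0 < t -> is_derive f t (df t)) ->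
  (forall t, 0 < t -> is_derive df t (ddf t)) ->
  (forall t, 0 < t -> 0 <= ddf t) ->
  forall m t, 0 < m -> 0 < t -> f m + df m * (t - m) <= f t.
Proof.
intros Hf Hdf Hddf m t Hm Ht.
destruct (MVT_gen f m t df) as [c [Hc Heq]].
- intros s Hs; apply Hf.
  assert (0 < Rmin m t) by (apply Rmin_pos; lra); lra.
- intros s Hs; apply derivable_continuous_pt; exists (df s).
  apply is_derive_Reals, Hf.
  assert (0 < Rmin m t) by (apply Rmin_pos; lra); lra.
- assert (Hmono := nondecreasing_of_derive df ddf Hdf Hddf).
  destruct (Rle_dec m t) as [H|H].
  + rewrite Rmin_left, Rmax_right in Hc by lra.
    assert (df m <= df c) by (apply Hmono; lra). nra.
  + rewrite Rmin_right, Rmax_left in Hc by lra.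
    assert (df c <= df m) by (apply Hmono; lra). nra.
Qed.

Lemma weighted_mean_pos (w x : nat -> R) (N : nat) :
  (forall k, (k <= N)%nat -> 0 < x k) ->
  (forall k, (k <= N)%nat -> 0 <= w k) ->
  sum_f_R0 w N = 1 ->
  0 < sum_f_R0 (fun k => w k * x k) N.
Proof.
intros Hx Hw Hsum.
(* The smallest of the finitely many points bounds the mean from below. *)
assert (Hmin : exists c, 0 < c /\ forall k, (k <= N)%nat -> c <= x k).
{ clear Hw Hsum; induction N as [|N IH].
  - exists (x O); split; [apply Hx; lia|].
    intros k Hk; replace k with O by lia; lra.
  - destruct IH as [c [Hc Hle]]; [intros; apply Hx; lia|].
    exists (Rmin c (x (S N))); split.
    + apply Rmin_pos; [lra | apply Hx; lia].
    + intros k Hk; destruct (Nat.eq_dec k (S N)) as [->|Hne].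
      * apply Rmin_r.
      * eapply Rle_trans; [apply Rmin_l | apply Hle; lia]. }
destruct Hmin as [c [Hc Hle]].
apply Rlt_le_trans with (c * sum_f_R0 w N); [rewrite Hsum; lra|].
rewrite scal_sum; apply sum_Rle; intros k Hk.
specialize (Hle k Hk); specialize (Hw k Hk); nra.
Qed.

(** The tangent at the weighted mean lies below the graph; averaging it over
    the points leaves only its value at the mean. *)
Lemma jensen_of_second_derivative (f df ddf : R -> R)
  (w x : nat -> R) (N : nat) :
  (forall t, 0 < t -> is_derive f t (df t)) ->
  (forall t, 0 < t -> is_derive df t (ddf t)) ->
  (forall t, 0 < t -> 0 <= ddf t) ->
  (forall k, (k <= N)%nat -> 0 < x k) ->
  (forall k, (k <= N)%nat -> 0 <= w k) ->
  sum_f_R0 w N = 1 ->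
  f (sum_f_R0 (fun k => w k * x k) N) <= sum_f_R0 (fun k => w k * f (x k)) N.
Proof.
intros Hf Hdf Hddf Hx Hw Hsum.
assert (Hm := weighted_mean_pos w x N Hx Hw Hsum).
set (m := sum_f_R0 (fun k => w k * x k) N) in *.
replace (f m)
  with (sum_f_R0 (fun k => w k * (f m - df m * m) + w k * x k * df m) N).
- apply sum_Rle; intros k Hk.
  assert (Ht := tangent_line_below f df ddf Hf Hdf Hddf m (x k) Hm (Hx k Hk)).
  specialize (Hw k Hk).
  replace (w k * (f m - df m * m) + w k * x k * df m)
    with (w k * (f m + df m * (x k - m))) by ring.
  apply Rmult_le_compat_l; lra.
- rewrite plus_sum, <- !scal_sum, Hsum. fold m. ring.
Qed.

Lemma is_lim_seq_sum_f_R0 (u : nat -> nat -> R) (l : nat -> R) (m : nat) :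
  (forall k, (k <= m)%nat -> is_lim_seq (u k) (l k)) ->
  is_lim_seq (fun N => sum_f_R0 (fun k => u k N) m) (sum_f_R0 l m).
Proof.
induction m as [|m IH]; intros H; simpl.
- apply H; lia.
- apply is_lim_seq_plus'; [apply IH; intros|]; apply H; lia.
Qed.

Lemma is_derive_sum_f_R0 (f df : nat -> R -> R) (N : nat) (t : R) :
  (forall k, (k <= N)%nat -> is_derive (f k) t (df k t)) ->
  is_derive (fun s => sum_f_R0 (fun k => f k s) N) t
    (sum_f_R0 (fun k => df k t) N).
Proof.
induction N as [|N IH]; intros H; simpl.
- apply H; lia.
- apply (is_derive_plus (fun s => sum_f_R0 (fun k => f k s) N) (f (S N))).
  + apply IH; intros; apply H; lia.
  + apply H; lia.
Qed.

(** * The kernel of the second derivative *)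

(** The integral of [qkernel q] over [t, +oo), and also the derivative of
    [ln (1 - q ^ t)]. *)
Definition qtail (q t : R) : R := - ln q * Rpower q t / (1 - Rpower q t).

(** The general term of the series for the derivative of the q-digamma
    function. *)
Definition qkernel (q t : R) : R :=
  (ln q) ^ 2 * Rpower q t / (1 - Rpower q t) ^ 2.

Lemma ln_q_neg (q : R) : 0 < q < 1 -> ln q < 0.
Proof. intros Hq; rewrite <- ln_1; apply ln_increasing; lra. Qed.

Lemma Rpower_pos (q t : R) : 0 < Rpower q t.
Proof. apply exp_pos. Qed.

Lemma Rpower_q_le (q s t : R) :
  0 < q < 1 -> s <= t -> Rpower q t <= Rpower q s.
Proof.
intros Hq Hst; assert (Hl := ln_q_neg q Hq); unfold Rpower.
destruct Hst as [Hst | ->]; [left; apply exp_increasing; nra | lra].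
Qed.

Lemma Rpower_q_lt_1 (q t : R) : 0 < q < 1 -> 0 < t -> Rpower q t < 1.
Proof.
intros Hq Ht; assert (Hl := ln_q_neg q Hq).
unfold Rpower; rewrite <- exp_0; apply exp_increasing; nra.
Qed.

Lemma ln_Rpower_q (q t : R) : ln (Rpower q t) = t * ln q.
Proof. apply ln_exp. Qed.

Lemma ln_le_pred (t : R) : 0 < t -> ln t <= t - 1.
Proof.
intros Ht; assert (H := exp_ineq1_le (ln t)); rewrite exp_ln in H; lra.
Qed.

Lemma is_derive_ln_qgap (q t : R) : 0 < q < 1 -> 0 < t ->
  is_derive (fun s => ln (1 - Rpower q s)) t (qtail q t).
Proof.
intros Hq Ht; assert (H1 := Rpower_q_lt_1 q t Hq Ht).
unfold qtail; unfold Rpower in *; auto_derive; [lra | field; lra].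
Qed.

Lemma is_derive_qtail (q t : R) : 0 < q < 1 -> 0 < t ->
  is_derive (fun s => qtail q s) t (- qkernel q t).
Proof.
intros Hq Ht; assert (H1 := Rpower_q_lt_1 q t Hq Ht).
unfold qtail, qkernel; unfold Rpower in *.
auto_derive; [lra | field; lra].
Qed.

Lemma qkernel_pos (q t : R) : 0 < q < 1 -> 0 < t -> 0 < qkernel q t.
Proof.
intros Hq Ht; assert (H1 := Rpower_q_lt_1 q t Hq Ht).
assert (H0 := Rpower_pos q t); assert (Hl := ln_q_neg q Hq).
unfold qkernel; apply Rdiv_lt_0_compat; [apply Rmult_lt_0_compat|];
  try apply pow2_gt_0; lra.
Qed.

(** The midpoint rule underestimates the integral over [q, 1] of the convex
    function [t |-> 1 / t]. *)
Lemma midpoint_ln (q : R) : 0 < q < 1 -> 2 * (1 - q) <= - ln q * (1 + q).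
Proof.
intros Hq.
assert (H : ln q - 2 * (q - 1) / (q + 1) <= ln 1 - 2 * (1 - 1) / (1 + 1)).
{ apply (nondecreasing_of_derive (fun t => ln t - 2 * (t - 1) / (t + 1))
           (fun t => (t - 1) ^ 2 / (t * (t + 1) ^ 2))); try lra.
  - intros t Ht; auto_derive; [repeat split; lra | field; lra].
  - intros t Ht; apply Rdiv_le_0_compat; [apply pow2_ge_0|].
    apply Rmult_lt_0_compat; nra. }
rewrite ln_1 in H.
assert (H' : ln q <= - (2 * (1 - q) / (1 + q))).
{ replace (- (2 * (1 - q) / (1 + q))) with (2 * (q - 1) / (q + 1))
    by (field; lra); lra. }
assert (He : 2 * (1 - q) / (1 + q) * (1 + q) = 2 * (1 - q)) by (field; lra).
nra.
Qed.

(** With [a = q ^ t], the claim reduces to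
    [r + q / r >= 2 (1 - q) / (- ln q)] for [r = (1 - q a) / (1 - a) >= 1].
    The left side increases with [r >= 1], so it is at least [1 + q], and the
    right side is at most [1 + q] by [midpoint_ln]. *)
Lemma qkernel_trapezoid (q t : R) : 0 < q < 1 -> 0 < t ->
  qtail q t - qtail q (t + 1) <= (qkernel q t + qkernel q (t + 1)) / 2.
Proof.
intros Hq Ht; assert (Ha1 := Rpower_q_lt_1 q t Hq Ht).
assert (Ha0 := Rpower_pos q t); assert (Hl := ln_q_neg q Hq).
assert (HT := midpoint_ln q Hq).
unfold qtail, qkernel; rewrite Rpower_plus, Rpower_1 by lra.
set (a := Rpower q t) in *; set (L := ln q) in *.
assert (Hc : 0 < 1 - a * q) by nra.
assert (Hb : 0 < 1 - a) by lra.
set (b := 1 - a) in *; set (c := 1 - a * q) in *.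
apply Rminus_le_0.
replace ((L ^ 2 * a / b ^ 2 + L ^ 2 * (a * q) / c ^ 2) / 2 -
         (- L * a / b - - L * (a * q) / c))
  with (- L * a * (- L * (c ^ 2 + q * b ^ 2) - 2 * (1 - q) * (b * c))
        / (2 * b ^ 2 * c ^ 2)).
2: { unfold b, c in *; field; lra. }
apply Rdiv_le_0_compat.
2: { apply Rmult_lt_0_compat; nra. }
apply Rmult_le_pos; [nra|].
(* This is [r + q / r >= 1 + q] with [r = c / b]. *)
assert (Hbc : (1 + q) * (b * c) <= c ^ 2 + q * b ^ 2).
{ assert (0 <= (c - b) * (c - q * b)).
  { apply Rmult_le_pos; unfold b, c; nra. }
  nra. }
assert (0 < b * c) by nra.
nra.
Qed.

Lemma qtail_le_sum_qkernel (q t : R) (N : nat) : 0 < q < 1 -> 0 < t ->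
  qtail q t - qtail q (t + 1 + INR N)
  <= qkernel q t / 2 + sum_f_R0 (fun j => qkernel q (t + 1 + INR j)) N.
Proof.
intros Hq Ht.
(* The trapezoidal rule counts the last node with weight one half. *)
assert (H : qtail q t - qtail q (t + 1 + INR N)
  <= qkernel q t / 2 + sum_f_R0 (fun j => qkernel q (t + 1 + INR j)) N
     - qkernel q (t + 1 + INR N) / 2).
{ induction N as [|N IH].
  - simpl; rewrite Rplus_0_r.
    assert (H := qkernel_trapezoid q t Hq Ht); lra.
  - assert (HN := pos_INR N).
    assert (H := qkernel_trapezoid q (t + 1 + INR N) Hq ltac:(lra)).
    rewrite tech5, S_INR, <- !Rplus_assoc; lra. }
assert (HN := pos_INR N).
assert (H1 := qkernel_pos q (t + 1 + INR N) Hq ltac:(lra)); lra.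
Qed.

(** The left side is the integral of a decreasing kernel over an interval of
    length [b]. The inequality comes down to [1 - q ^ b <= - b ln q]. *)
Lemma qtail_diff_le (q t b : R) : 0 < q < 1 -> 0 < t -> 0 <= b ->
  qtail q t - qtail q (t + b) <= b * qkernel q t.
Proof.
intros Hq Ht Hb; assert (Ha1 := Rpower_q_lt_1 q t Hq Ht).
assert (Ha0 := Rpower_pos q t); assert (Hl := ln_q_neg q Hq).
assert (HB := ln_le_pred (Rpower q b) (Rpower_pos q b)).
rewrite ln_Rpower_q in HB.
assert (HB0 := Rpower_pos q b).
assert (HB1 : Rpower q b <= 1).
{ rewrite <- (Rpower_O q) by lra; apply Rpower_q_le; lra. }
unfold qtail, qkernel; rewrite Rpower_plus.
set (a := Rpower q t) in *; set (L := ln q) in *; set (B := Rpower q b) in *.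
assert (Hc : 1 - a <= 1 - a * B) by nra.
apply Rminus_le_0.
replace (b * (L ^ 2 * a / (1 - a) ^ 2) -
         (- L * a / (1 - a) - - L * (a * B) / (1 - a * B)))
  with (- L * a * (b * - L * (1 - a * B) - (1 - B) * (1 - a))
        / ((1 - a) ^ 2 * (1 - a * B))) by (field; lra).
apply Rdiv_le_0_compat.
2: { apply Rmult_lt_0_compat; nra. }
apply Rmult_le_pos; nra.
Qed.

Lemma qkernel_le (q s t : R) : 0 < q < 1 -> 0 < s -> s <= t ->
  qkernel q t <= qkernel q s.
Proof.
intros Hq Hs Hst; assert (Hs1 := Rpower_q_lt_1 q s Hq Hs).
assert (Ht0 := Rpower_pos q t); assert (Hle := Rpower_q_le q s t Hq Hst).
unfold qkernel, Rdiv; apply Rmult_le_compat.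
- apply Rmult_le_pos; [apply pow2_ge_0 | lra].
- left; apply Rinv_0_lt_compat; nra.
- apply Rmult_le_compat_l; [apply pow2_ge_0 | lra].
- apply Rinv_le_contravar; nra.
Qed.

(** An explicit constant is preferable to [qtail q (t + INR N)] itself: it
    dominates these tails uniformly in [t >= 1], so that it can be the second
    derivative of a multiple of [t ^ 2]. *)
Definition tail_bound (q : R) (N : nat) : R := - ln q / (1 - q) * q ^ N.

Lemma qtail_le_tail_bound (q t : R) (N : nat) : 0 < q < 1 -> 1 <= t ->
  qtail q (t + INR N) <= tail_bound q N.
Proof.
intros Hq Ht; assert (Hl := ln_q_neg q Hq).
assert (HN := pos_INR N).
assert (H0 := Rpower_pos q (t + INR N)).
assert (H1 : Rpower q (t + INR N) <= q).
{ rewrite <- (Rpower_1 q) at 2 by lra; apply Rpower_q_le; lra. }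
assert (H2 : Rpower q (t + INR N) <= q ^ N).
{ rewrite <- Rpower_pow by lra; apply Rpower_q_le; lra. }
unfold qtail, tail_bound, Rdiv.
rewrite (Rmult_assoc _ (/ (1 - q))), (Rmult_comm (/ (1 - q))), <- Rmult_assoc.
apply Rmult_le_compat; try nra.
- left; apply Rinv_0_lt_compat; lra.
- apply Rinv_le_contravar; lra.
Qed.

Lemma is_lim_seq_tail_bound (q : R) :
  0 < q < 1 -> is_lim_seq (tail_bound q) 0.
Proof.
intros Hq; unfold tail_bound.
replace (Finite 0) with (Rbar_mult (- ln q / (1 - q)) 0)
  by (simpl; f_equal; ring).
apply is_lim_seq_scal_l, is_lim_seq_geom; rewrite Rabs_right; lra.
Qed.

(** On [t, t + beta - 1] the integral of the kernel is at most
    [(beta - 1) * qkernel q t]. From there to [t + beta + N] the trapezoidal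
    rule applies, and the half weight of its first node costs at most
    [qkernel q t / 2]. The last summand covers the rest of the half-line. *)
Lemma second_derivative_nonneg (q alpha beta t : R) (N : nat) :
  0 < q < 1 -> 0 < t -> 2 * alpha <= 1 -> 1 <= beta ->
  0 <= sum_f_R0 (fun j => qkernel q (INR j + (t + beta))) N
       - qtail q t + (beta - alpha) * qkernel q t + tail_bound q N.
Proof.
intros Hq Ht Ha Hb.
assert (H1 := qtail_diff_le q t (beta - 1) Hq Ht ltac:(lra)).
assert (H2 := qtail_le_sum_qkernel q (t + (beta - 1)) N Hq ltac:(lra)).
assert (H3 := qtail_le_tail_bound q (t + beta) N Hq ltac:(lra)).
assert (H4 := qkernel_le q t (t + (beta - 1)) Hq Ht ltac:(lra)).
assert (H5 := qkernel_pos q t Hq Ht).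
replace (t + (beta - 1) + 1) with (t + beta) in H2 by ring.
rewrite (sum_eq _ (fun j => qkernel q (INR j + (t + beta)))) in H2
  by (intros; f_equal; ring).
nra.
Qed.

(** * The dilogarithm *)

(** Since [Li2] is differentiated only inside (0, 1), the removable
    singularity matters for integrability alone. *)
Definition Li2_integrand_ext (t : R) : R :=
  if Req_EM_T t 0 then -1 else ln (1 - t) / t.

Lemma continuous_Li2_integrand (t : R) : 0 < t < 1 ->
  continuous (fun s => ln (1 - s) / s) t.
Proof.
intros Ht; apply (@ex_derive_continuous R_AbsRing R_NormedModule).
auto_derive; lra.
Qed.

Lemma continuous_Li2_integrand_ext (t : R) : 0 <= t < 1 ->
  continuous Li2_integrand_ext t.
Proof.
intros Ht; destruct (Req_dec t 0) as [->|Hne].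
- apply continuity_pt_filterlim, continuity_pt_filterlim'.
  unfold Li2_integrand_ext at 2; destruct (Req_EM_T 0 0) as [_|]; [|lra].
  change (is_lim Li2_integrand_ext 0 (-1)).
  apply is_lim_ext_loc with (fun s => - (ln (1 + (- s)) / (- s))).
  + exists (mkposreal 1 Rlt_0_1); intros s _ Hs.
    unfold Li2_integrand_ext; destruct (Req_EM_T s 0); [lra|].
    unfold Rminus; field; assumption.
  + apply (is_lim_opp _ _ 1).
    apply (is_lim_comp (fun y => ln (1 + y) / y) Ropp 0 1 0).
    * apply is_lim_div_ln1p_0.
    * replace (Finite 0) with (Rbar_opp 0) at 2 by (simpl; f_equal; ring).
      apply is_lim_opp, is_lim_id.
    * exists (mkposreal 1 Rlt_0_1); intros s _ Hs E.
      injection E; lra.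
- apply continuous_ext_loc with (fun s => ln (1 - s) / s).
  + assert (Hp : 0 < t) by lra.
    exists (mkposreal t Hp); intros s Hs.
    apply Rabs_def2 in Hs; unfold minus, plus, opp in Hs; simpl in Hs.
    unfold Li2_integrand_ext; destruct (Req_EM_T s 0); [lra | reflexivity].
  + apply continuous_Li2_integrand; lra.
Qed.

Lemma is_derive_Li2 (z : R) : 0 < z < 1 ->
  is_derive Li2 z (- (ln (1 - z) / z)).
Proof.
intros Hz; unfold Li2.
apply (is_derive_opp (fun z => RInt (fun t => ln (1 - t) / t) 0 z)).
apply (is_derive_RInt (fun t => ln (1 - t) / t) _ 0).
2: apply continuous_Li2_integrand; lra.
assert (Hd : 0 < Rmin z (1 - z)) by (apply Rmin_pos; lra).
exists (mkposreal _ Hd); intros s Hs; simpl in Hs.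
assert (Hm1 := Rmin_l z (1 - z)); assert (Hm2 := Rmin_r z (1 - z)).
apply Rabs_def2 in Hs; unfold minus, plus, opp in Hs; simpl in Hs.
apply (@RInt_correct R_CompleteNormedModule).
apply ex_RInt_ext with Li2_integrand_ext.
- intros t; rewrite Rmin_left by lra; intros Ht.
  unfold Li2_integrand_ext; destruct (Req_EM_T t 0); [lra | reflexivity].
- apply (@ex_RInt_continuous R_CompleteNormedModule).
  intros t; rewrite Rmin_left, Rmax_right by lra; intros Ht.
  apply continuous_Li2_integrand_ext; lra.
Qed.

Lemma is_derive_Li2_qgap (q t : R) : 0 < q < 1 -> 0 < t ->
  is_derive (fun s => Li2 (1 - Rpower q s) / ln q) t (- t * qtail q t).
Proof.
intros Hq Ht; assert (H1 := Rpower_q_lt_1 q t Hq Ht).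
assert (H0 := Rpower_pos q t); assert (Hl := ln_q_neg q Hq).
assert (H2 : is_derive (fun s => 1 - Rpower q s) t (- (ln q * Rpower q t))).
{ unfold Rpower; auto_derive; trivial; ring. }
assert (H3 := is_derive_comp Li2 _ t _ _ (is_derive_Li2 (1 - Rpower q t) ltac:(lra)) H2).
apply (is_derive_scal_l _ _ _ (/ ln q)) in H3.
replace (- t * qtail q t) with
  (scal (scal (- (ln q * Rpower q t))
     (- (ln (1 - (1 - Rpower q t)) / (1 - Rpower q t)))) (/ ln q)).
- exact H3.
- unfold scal; simpl; unfold mult; simpl; unfold qtail.
  replace (1 - (1 - Rpower q t)) with (Rpower q t) by ring.
  rewrite ln_Rpower_q; field; lra.
Qed.

(** * The logarithm of the q-gamma function *)

(** Comparison with a geometric series: [- ln (1 - u) <= u / (1 - u)] with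
    [u = q ^ (j + s) <= q ^ s]. *)
Lemma ex_series_ln_qgap (q s : R) : 0 < q < 1 -> 0 < s ->
  ex_series (fun j => ln (1 - Rpower q (INR j + s))).
Proof.
intros Hq Hs; assert (H1 := Rpower_q_lt_1 q s Hq Hs).
assert (H0 := Rpower_pos q s).
apply (@ex_series_le R_AbsRing R_CompleteNormedModule)
  with (fun j => Rpower q s / (1 - Rpower q s) * q ^ j).
2: { apply (ex_series_scal (Rpower q s / (1 - Rpower q s)) (fun j => q ^ j)).
     apply ex_series_geom; rewrite Rabs_right; lra. }
intros j; change (Rabs (ln (1 - Rpower q (INR j + s)))
  <= Rpower q s / (1 - Rpower q s) * q ^ j).
assert (Hj := pos_INR j).
assert (Hu1 := Rpower_q_le q s (INR j + s) Hq ltac:(lra)).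
assert (Hu0 := Rpower_pos q (INR j + s)).
assert (Hu : Rpower q (INR j + s) = q ^ j * Rpower q s)
  by (rewrite Rpower_plus, Rpower_pow by lra; reflexivity).
set (u := Rpower q (INR j + s)) in *; set (b := Rpower q s) in *.
assert (Hneg := ln_le_pred (1 - u) ltac:(lra)).
rewrite Rabs_left1 by lra.
rewrite <- ln_Rinv by lra.
eapply Rle_trans;
  [apply ln_le_pred, Rinv_0_lt_compat; lra|].
replace (/ (1 - u) - 1) with (u * / (1 - u)) by (field; lra).
replace (b / (1 - b) * q ^ j) with (u * / (1 - b)) by (rewrite Hu; field; lra).
apply Rmult_le_compat_l; [lra | apply Rinv_le_contravar; lra].
Qed.

Definition log_partial (q y : R) (N : nat) : R :=
  sum_f_R0 (fun j => ln (1 - Rpower q (INR j + 1))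
                     - ln (1 - Rpower q (INR j + y))) N.

Lemma exp_log_partial (q y : R) (N : nat) : 0 < q < 1 -> 0 < y ->
  prod_f_R0 (fun j => (1 - q ^ (j + 1)) / (1 - Rpower q (INR j + y))) N
  = exp (log_partial q y N).
Proof.
intros Hq Hy.
assert (Hfac : forall j, (1 - q ^ (j + 1)) / (1 - Rpower q (INR j + y))
  = exp (ln (1 - Rpower q (INR j + 1)) - ln (1 - Rpower q (INR j + y)))).
{ intros j; assert (Hj := pos_INR j).
  assert (H1 := Rpower_q_lt_1 q (INR j + y) Hq ltac:(lra)).
  assert (H2 := Rpower_q_lt_1 q (INR j + 1) Hq ltac:(lra)).
  rewrite <- Rpower_pow, plus_INR by lra; simpl (INR 1).
  rewrite <- ln_div, exp_ln; try lra.
  apply Rdiv_lt_0_compat; lra. }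
unfold log_partial; induction N as [|N IH].
- exact (Hfac O).
- rewrite tech5, exp_plus, <- IH, <- Hfac; reflexivity.
Qed.

(** The partial products are exponentials of the partial sums of a convergent
    series, so their limit is finite and nonzero; in particular the total
    operators [Lim_seq] and [real] return the genuine limit. *)
Lemma ln_Gamma_q (q y : R) : 0 < q < 1 -> 0 < y ->
  0 < Gamma_q q y /\
  is_lim_seq (log_partial q y) (ln (Gamma_q q y) - (1 - y) * ln (1 - q)).
Proof.
intros Hq Hy.
assert (Hlim : exists l : R, is_lim_seq (log_partial q y) l).
{ destruct (ex_series_minus _ _ (ex_series_ln_qgap q 1 Hq Rlt_0_1)
              (ex_series_ln_qgap q y Hq Hy)) as [l Hl].
  exists l; apply is_lim_seq_ext with (2 := Hl).
  intros N; apply sum_n_Reals. }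
destruct Hlim as [l Hl].
assert (HG : Gamma_q q y = exp ((1 - y) * ln (1 - q) + l)).
{ unfold Gamma_q.
  rewrite (Lim_seq_ext _ (fun N => exp (log_partial q y N)))
    by (intros N; apply exp_log_partial; assumption).
  rewrite (is_lim_seq_unique _ (exp l)).
  - rewrite exp_plus; reflexivity.
  - apply is_lim_seq_continuous; [|assumption].
    apply derivable_continuous_pt, derivable_pt_exp. }
rewrite HG, ln_exp; split; [apply exp_pos|].
replace ((1 - y) * ln (1 - q) + l - (1 - y) * ln (1 - q)) with l by ring.
assumption.
Qed.

(** * Convexity of the logarithmic defect *)

Definition log_defect (q alpha beta t : R) : R :=
  ln (Gamma_q q (t + beta))
  - (t + beta - alpha) * ln ((1 - Rpower q t) / (1 - q))
  - Li2 (1 - Rpower q t) / ln q.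

(** The infinite product is cut after [N + 1] factors, and the quadratic term
    restores the convexity that the missing factors would provide. *)
Definition log_defect_approx (q alpha beta : R) (N : nat) (t : R) : R :=
  log_partial q (t + beta) N + (1 - (t + beta)) * ln (1 - q)
  - (t + beta - alpha) * ln ((1 - Rpower q t) / (1 - q))
  - Li2 (1 - Rpower q t) / ln q
  + tail_bound q N * (t ^ 2 / 2).

Definition log_defect_approx' (q alpha beta : R) (N : nat) (t : R) : R :=
  - sum_f_R0 (fun j => qtail q (INR j + (t + beta))) N
  - ln (1 - Rpower q t) - (beta - alpha) * qtail q t + tail_bound q N * t.

Definition log_defect_approx'' (q alpha beta : R) (N : nat) (t : R) : R :=
  sum_f_R0 (fun j => qkernel q (INR j + (t + beta))) N
  - qtail q t + (beta - alpha) * qkernel q t + tail_bound q N.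

Lemma is_derive_shift (f : R -> R) (a b t l : R) :
  is_derive f (a + (t + b)) l -> is_derive (fun s => f (a + (s + b))) t l.
Proof.
intros H; rewrite <- (Rmult_1_l l).
apply (is_derive_comp f (fun s => a + (s + b))); [assumption|].
auto_derive; trivial.
Qed.

Lemma is_derive_log_partial (q b t : R) (N : nat) :
  0 < q < 1 -> 0 < t -> 0 <= b ->
  is_derive (fun s => log_partial q (s + b) N) t
    (- sum_f_R0 (fun j => qtail q (INR j + (t + b))) N).
Proof.
intros Hq Ht Hb; unfold log_partial.
replace (- sum_f_R0 (fun j => qtail q (INR j + (t + b))) N)
  with (sum_f_R0 (fun j => 0 - qtail q (INR j + (t + b))) N)
  by (rewrite minus_sum, sum_cte; ring).
apply (is_derive_sum_f_R0
  (fun j s => ln (1 - Rpower q (INR j + 1)) - ln (1 - Rpower q (INR j + (s + b))))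
  (fun j s => 0 - qtail q (INR j + (s + b)))).
intros j _; assert (Hj := pos_INR j).
apply (is_derive_minus (fun _ => ln (1 - Rpower q (INR j + 1)))).
- apply @is_derive_const.
- apply (is_derive_shift (fun s => ln (1 - Rpower q s))).
  apply is_derive_ln_qgap; lra.
Qed.

(** The dilogarithm contributes [t * qtail q t], which cancels the part of the
    derivative of [(t + beta - alpha) * ln (1 - q ^ t)] that grows with the
    factor [t]. *)
Lemma is_derive_log_defect_approx (q alpha beta t : R) (N : nat) :
  0 < q < 1 -> 0 < t -> 0 <= beta ->
  is_derive (log_defect_approx q alpha beta N) t
    (log_defect_approx' q alpha beta N t).
Proof.
intros Hq Ht Hb; assert (H1 := Rpower_q_lt_1 q t Hq Ht).
assert (HP := is_derive_log_partial q beta t N Hq Ht Hb).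
assert (HL := is_derive_Li2_qgap q t Hq Ht).
(* The remaining summands are elementary; the terms in [ln (1 - q)] add up to
   a constant and leave no trace in the derivative. *)
assert (HE : is_derive (fun s => (1 - (s + beta)) * ln (1 - q)
    - (s + beta - alpha) * ln ((1 - Rpower q s) / (1 - q))
    + tail_bound q N * (s ^ 2 / 2)) t
  (- ln (1 - Rpower q t) - (t + beta - alpha) * qtail q t
   + tail_bound q N * t)).
{ unfold qtail, Rpower in *; auto_derive.
  - apply Rdiv_lt_0_compat; lra.
  - change ((1 + - exp (t * ln q)) * / (1 - q))
      with ((1 - exp (t * ln q)) / (1 - q)).
    rewrite ln_div by lra; field; lra. }
assert (H := is_derive_plus _ _ _ _ _ (is_derive_minus _ _ _ _ _ HP HL) HE).
replace (log_defect_approx' q alpha beta N t) with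
  (plus (minus (- sum_f_R0 (fun j => qtail q (INR j + (t + beta))) N)
               (- t * qtail q t))
        (- ln (1 - Rpower q t) - (t + beta - alpha) * qtail q t
         + tail_bound q N * t)).
- refine (is_derive_ext _ _ _ _ _ H).
  intros s; unfold log_defect_approx, minus, plus, opp; simpl; ring.
- unfold log_defect_approx', minus, plus, opp; simpl; ring.
Qed.

Lemma is_derive_log_defect_approx' (q alpha beta t : R) (N : nat) :
  0 < q < 1 -> 0 < t -> 0 <= beta ->
  is_derive (log_defect_approx' q alpha beta N) t
    (log_defect_approx'' q alpha beta N t).
Proof.
intros Hq Ht Hb.
assert (HS : is_derive
  (fun s => sum_f_R0 (fun j => qtail q (INR j + (s + beta))) N) t
  (sum_f_R0 (fun j => - qkernel q (INR j + (t + beta))) N)).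
{ apply (is_derive_sum_f_R0 (fun j s => qtail q (INR j + (s + beta)))
           (fun j s => - qkernel q (INR j + (s + beta)))).
  intros j _; assert (Hj := pos_INR j).
  apply (is_derive_shift (fun s => qtail q s)), is_derive_qtail; lra. }
assert (HI := is_derive_scal _ _ (beta - alpha) _ (is_derive_qtail q t Hq Ht)).
assert (HL := is_derive_ln_qgap q t Hq Ht).
assert (HE : is_derive (fun s => tail_bound q N * s) t (tail_bound q N))
  by (auto_derive; trivial; ring).
assert (H := is_derive_plus _ _ _ _ _ (is_derive_minus _ _ _ _ _
  (is_derive_minus _ _ _ _ _ (is_derive_opp _ _ _ HS) HL) HI) HE).
refine (eq_rect _ (is_derive (log_defect_approx' q alpha beta N) t) H _ _).
unfold log_defect_approx''.
rewrite (sum_eq (fun j => - qkernel q (INR j + (t + beta)))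
          (fun j => qkernel q (INR j + (t + beta)) * -1))
  by (intros; ring).
rewrite <- scal_sum; unfold minus, plus, opp; simpl; ring.
Qed.

Lemma is_lim_seq_log_defect_approx (q alpha beta t : R) :
  0 < q < 1 -> 0 < t -> 0 <= beta ->
  is_lim_seq (fun N => log_defect_approx q alpha beta N t)
    (log_defect q alpha beta t).
Proof.
intros Hq Ht Hb.
destruct (ln_Gamma_q q (t + beta) Hq ltac:(lra)) as [_ HG].
assert (HT := is_lim_seq_scal_r _ (t ^ 2 / 2) _ (is_lim_seq_tail_bound q Hq)).
set (c := (1 - (t + beta)) * ln (1 - q)
  - (t + beta - alpha) * ln ((1 - Rpower q t) / (1 - q))
  - Li2 (1 - Rpower q t) / ln q).
assert (H := is_lim_seq_plus' _ _ _ _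
  (is_lim_seq_plus' _ _ _ _ HG (is_lim_seq_const c)) HT).
replace (log_defect q alpha beta t) with
  (ln (Gamma_q q (t + beta)) - (1 - (t + beta)) * ln (1 - q) + c
   + 0 * (t ^ 2 / 2)) by (unfold log_defect, c; ring).
refine (is_lim_seq_ext _ _ _ _ H).
intros N; unfold log_defect_approx, c; ring.
Qed.

Lemma log_defect_jensen (q alpha beta : R) (w x : nat -> R) (m : nat) :
  0 < q < 1 -> 2 * alpha <= 1 -> 1 <= beta ->
  (forall k, (k <= m)%nat -> 0 < x k) ->
  (forall k, (k <= m)%nat -> 0 <= w k) ->
  sum_f_R0 w m = 1 ->
  log_defect q alpha beta (sum_f_R0 (fun k => w k * x k) m)
  <= sum_f_R0 (fun k => w k * log_defect q alpha beta (x k)) m.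
Proof.
intros Hq Ha Hb Hx Hw Hsum.
assert (Hm := weighted_mean_pos w x m Hx Hw Hsum).
apply (is_lim_seq_le
  (fun N => log_defect_approx q alpha beta N (sum_f_R0 (fun k => w k * x k) m))
  (fun N => sum_f_R0 (fun k => w k * log_defect_approx q alpha beta N (x k)) m)
  (Finite _) (Finite _)).
- intros N.
  apply jensen_of_second_derivative
    with (log_defect_approx' q alpha beta N) (log_defect_approx'' q alpha beta N);
    trivial; intros t Ht.
  + apply is_derive_log_defect_approx; lra.
  + apply is_derive_log_defect_approx'; lra.
  + apply second_derivative_nonneg; lra.
- apply is_lim_seq_log_defect_approx; lra.
- apply (is_lim_seq_sum_f_R0
    (fun k N => w k * log_defect_approx q alpha beta N (x k))).
  intros k Hk.
  apply (is_lim_seq_scal_l _ (w k) (log_defect q alpha beta (x k))).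
  apply is_lim_seq_log_defect_approx; try lra; auto.
Qed.

Lemma prod_f_exp (s n : nat) (f g : nat -> R) :
  (forall k, f k = exp (g k)) -> prod_f s n f = exp (sum_f s n g).
Proof.
intros H; unfold prod_f, sum_f.
induction (n - s)%nat as [|N IH]; simpl; [apply H|].
rewrite IH, exp_plus, H; reflexivity.
Qed.

Theorem corollary1 (q : R) (n : nat) (x p : nat -> R) (alpha beta : R)
  (hq : 0 < q < 1)
  (hn : (1 <= n)%nat)
  (hx : forall k : nat, (1 <= k <= n)%nat -> 0 < x k)
  (hp : forall k : nat, (1 <= k <= n)%nat -> 0 <= p k)
  (hp1 : sum_f 1 n p = 1)
  (halpha : 2 * alpha <= 1)
  (hbeta : 1 <= beta) :
  let xbar := sum_f 1 n (fun k => p k * x k) in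
  Gamma_q q (xbar + beta)
    / prod_f 1 n (fun k => Rpower (Gamma_q q (x k + beta)) (p k))
  <=
  Rpower ((1 - Rpower q xbar) / (1 - q)) (xbar + beta - alpha)
    / prod_f 1 n (fun k =>
        Rpower ((1 - Rpower q (x k)) / (1 - q)) (p k * (x k + beta - alpha)))
  * exp ((Li2 (1 - Rpower q xbar)
            - sum_f 1 n (fun k => p k * Li2 (1 - Rpower q (x k)))) / ln q).
Proof.
intros xbar.
assert (Hx : forall k, (k <= n - 1)%nat -> 0 < x (k + 1)%nat)
  by (intros; apply hx; lia).
assert (Hp : forall k, (k <= n - 1)%nat -> 0 <= p (k + 1)%nat)
  by (intros; apply hp; lia).
assert (Hl := ln_q_neg q hq).
assert (HJ := log_defect_jensen q alpha beta (fun k => p (k + 1)%nat)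
  (fun k => x (k + 1)%nat) (n - 1) hq halpha hbeta Hx Hp hp1).
assert (Hm := weighted_mean_pos (fun k => p (k + 1)%nat)
  (fun k => x (k + 1)%nat) (n - 1) Hx Hp hp1).
cbv beta in HJ, Hm.
change (sum_f_R0 (fun k => p (k + 1)%nat * x (k + 1)%nat) (n - 1))
  with xbar in HJ, Hm.
destruct (ln_Gamma_q q (xbar + beta) hq ltac:(lra)) as [HG _].
rewrite <- (exp_ln _ HG).
rewrite (prod_f_exp 1 n _ (fun k => p k * ln (Gamma_q q (x k + beta))))
  by reflexivity.
rewrite (prod_f_exp 1 n (fun k => Rpower ((1 - Rpower q (x k)) / (1 - q)) _)
  (fun k => p k * (x k + beta - alpha) * ln ((1 - Rpower q (x k)) / (1 - q))))
  by reflexivity.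
unfold Rpower at 1, Rdiv at 1 2.
rewrite <- !exp_Ropp, <- !exp_plus.
apply Rnot_lt_le; intros Hlt; apply exp_lt_inv in Hlt.
revert Hlt; apply Rle_not_lt.
(* Split the mean of the defects into the three sums of the statement. *)
rewrite (sum_eq _ (fun k =>
  p (k + 1)%nat * ln (Gamma_q q (x (k + 1)%nat + beta))
  - p (k + 1)%nat * (x (k + 1)%nat + beta - alpha)
    * ln ((1 - Rpower q (x (k + 1)%nat)) / (1 - q))
  - p (k + 1)%nat * Li2 (1 - Rpower q (x (k + 1)%nat)) * / ln q)) in HJ
  by (intros; unfold log_defect; field; lra).
rewrite !minus_sum, <- scal_sum in HJ.
unfold log_defect, sum_f in *.
unfold Rdiv in *; rewrite (Rmult_minus_distr_r _ _ (/ ln q)).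
lra.
Qed.
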